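(* Let $[\boldsymbol D,\boldsymbol o]$ be a unimodular discrete space. (i) Let $\alpha,c,M>0$ and assume there exists an equivariant weight function $\boldsymbol w$ such that almost surely, for all $r\ge M$, $\boldsymbol w(N_r(\boldsymbol o))\le c\,r^{\alpha}$. Then $$\mathcal H^{\alpha}_M(\boldsymbol D)\ \ge\ \frac1c\,\mathbb E[\boldsymbol w(\boldsymbol o)].$$ (ii) If in addition $\boldsymbol w_{\boldsymbol D}(\cdot)$ is non-degenerate with positive probability, i.e. $\mathbb P[\exists v\in\boldsymbol D:\boldsymbol w_{\boldsymbol D}(v)\neq0]>0$, then $\mathrm{udim}_H(\boldsymbol D)\le\alpha$.
   Context: A discrete space is a metric space $D$ in which every closed ball $N_r(v)=\{u\in D:d(u,v)\le r\}$ is finite; by convention $N_0(v)=\emptyset$. $\mathcal D_*$ (resp. $\mathcal D_{**}$) is the set of discrete spaces with one (resp. two) distinguished points modulo isometries preserving the distinguished points, with its natural Borel structure (local Gromov–Hausdorff topology); $[D,o]$ denotes the class of $(D,o)$. If points (or pairs of points) carry marks in a complete separable metric space $\Xi$, one gets the analogous space $\mathcal D'_*$ of classes $[D,o;m]$ modulo mark-preserving pointed isometries. A random pointed (marked) discrete space $[\boldsymbol D,\boldsymbol o]$ is unimodular if the mass transport principle holds: for every measurable $g\ge0$ on doubly pointed (marked) spaces, $\mathbb E\big[\sum_{v\in\boldsymbol D}g(\boldsymbol D,\boldsymbol o,v)\big]=\mathbb E\big[\sum_{v\in\boldsymbol D}g(\boldsymbol D,v,\boldsymbol o)\big]$. An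 equivariant process $\boldsymbol Z$ with values in $\Xi$ assigns to each (deterministic) discrete space $D$ a random marking $\boldsymbol Z_D:D\to\Xi$ (extra randomness is allowed) such that (a) for every isometry $\rho:D_1\to D_2$, $\boldsymbol Z_{D_2}\circ\rho$ has the same law as $\boldsymbol Z_{D_1}$, and (b) for every measurable $A\subseteq\mathcal D'_*$, the map $[D,o]\mapsto\mathbb P([D,o;\boldsymbol Z_D]\in A)$ is measurable. When a random $[\boldsymbol D,\boldsymbol o]$ is fixed, it suffices to define $\boldsymbol Z$ on almost every realization, and $\boldsymbol Z_{\boldsymbol D}$ is sampled conditionally on $\boldsymbol D$. An equivariant weight function $\boldsymbol w$ is an equivariant process with values in $\mathbb R^{\ge0}$; $\boldsymbol w(v):=\boldsymbol w_D(v)$ and $\boldsymbol w(S):=\sum_{v\in S}\boldsymbol w(v)$ for $S\subseteq D$. An equivariant covering is an equivariant process $\boldsymbol R$ with values in $\mathbb R^{\ge0}$ such that almost surely $\bigcup_{v\in\boldsymbol D}N_{\boldsymbol R(v)}(v)=\boldsymbol D$ (the value $\boldsymbol R(v)=0$ means no ball at $v$). Put $$\mathcal H^{\alpha}_M(\boldsymbol D):=\inf\{\mathbb E[\boldsymbol R(\boldsymbol o)^{\alpha}]\},$$ the infimum being over equivariant coverings with $\boldsymbol R(v)\in\{0\}\cup[M,\infty)$ for all $v$ a.s. (with $0^0:=0$). The unimodular Hausdorff dimension is $\mathrm{udim}_H(\boldsymbol D):=\sup\{\alpha\ge0:\mathcal H^{\alpha}_1(\boldsymbol D)=0\}$. 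*)

(* Defs.v *)
From HB Require Import structures.
From mathcomp Require Import all_boot all_order all_algebra.
From mathcomp Require Import generic_quotient.
From mathcomp Require Import all_classical all_reals all_analysis.
From mathcomp Require Import measurable_realfun.
Set Implicit Arguments.
Unset Strict Implicit.
Unset Printing Implicit Defensive.
Import Order.TTheory GRing.Theory Num.Theory.
Import numFieldTopology.Exports numFieldNormedType.Exports.
Local Open Scope classical_set_scope.
Local Open Scope quotient_scope.
Local Open Scope ring_scope.

(* A field of type [metricType R] (or its class) instead of the first five
   fields would make the isometry classes too large to form a [measurableType];
   the [metricType] structure is declared just below. *)
Record discreteSpace (R : realType) := DiscreteSpace {
  carrier :> Type ;
  dist : carrier -> carrier -> R ;
  dist_xx : forall x, dist x x = 0 ;
  dist_eq0 : forall x y, dist x y = 0 -> x = y ;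
  dist_sym : forall x y, dist x y = dist y x ;
  dist_triangle : forall y x z, dist x z <= dist x y + dist y z ;
  finite_balls : forall v r, finite_set [set u | dist v u <= r] }.

HB.instance Definition _ (R : realType) (D : discreteSpace R) :=
  gen_eqMixin D.
HB.instance Definition _ (R : realType) (D : discreteSpace R) :=
  gen_choiceMixin D.
HB.instance Definition _ (R : realType) (D : discreteSpace R) :=
  @isMetric.Build R D (@dist R D) (@dist_xx R D) (@dist_eq0 R D)
    (@dist_sym R D) (@dist_triangle R D).

(* For r = 0 this is empty, not {v}. *)
Definition cball (R : realType) (D : discreteSpace R) (r : R) (v : D) : set D :=
  [set u | 0 < r /\ mdist v u <= r].

Definition isometry (R : realType) (D1 D2 : discreteSpace R) (rho : D1 -> D2) :=
  bijective rho /\ forall u v, mdist (rho u) (rho v) = mdist u v.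

Section marked_spaces.
Context {R : realType}.

(* Discrete spaces with k distinguished points and marks in Xi. *)
Record markedSpace (k : nat) (Xi : metricType R) := MarkedSpace {
  space :> discreteSpace R ;
  pts : k.-tuple space ;
  mark : space -> Xi }.

Definition origin k Xi (x : markedSpace k.+1 Xi) : x := tnth (pts x) ord0.

Section isometry_classes.
Variables (k : nat) (Xi : metricType R).
Implicit Types x y z : markedSpace k Xi.

Definition marked_isometric x y := exists rho : x -> y,
  [/\ isometry rho,
      forall i, rho (tnth (pts x) i) = tnth (pts y) i &
      forall v, mark (rho v) = mark v].

Let isom x y : bool := `[< marked_isometric x y >].

Let isom_refl : reflexive isom.
Proof. by move=> x; apply/asboolP; exists id; split=> //; split=> //; exists id. Qed.

Let isom_sym1 x y : isom x y -> isom y x.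
Proof.
move=> /asboolP[f [[[g fg gf] fd] fp fm]]; apply/asboolP; exists g; split.
- by split=> [|u v]; [exists f | rewrite -fd !gf].
- by move=> i; rewrite -fp fg.
- by move=> v; rewrite -fm gf.
Qed.

Let isom_sym : symmetric isom.
Proof. by move=> x y; apply/idP/idP; apply: isom_sym1. Qed.

Let isom_trans : transitive isom.
Proof.
move=> y x z /asboolP[f [[fb fd] fp fm]] /asboolP[g [[gb gd] gp gm]].
apply/asboolP; exists (g \o f); split.
- by split=> [|u v]; [exact: bij_comp | rewrite /= gd fd].
- by move=> i /=; rewrite fp gp.
- by move=> v /=; rewrite gm fm.
Qed.

HB.instance Definition _ := gen_eqMixin (markedSpace k Xi).
HB.instance Definition _ := gen_choiceMixin (markedSpace k Xi).

Canonical isom_equiv := EquivRel isom isom_refl isom_sym isom_trans.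

Definition isoClass := {eq_quot isom_equiv}.

HB.instance Definition _ := Choice.on isoClass.

Definition cls x : isoClass := \pi_({eq_quot isom_equiv}) x.
Definition rep (a : isoClass) : markedSpace k Xi := repr (a : {eq_quot isom_equiv}).

Lemma repK : cancel rep cls. Proof. exact: reprK. Qed.

Lemma clsP x y : cls x = cls y <-> marked_isometric x y.
Proof.
split=> [/eqquotP h|h]; first exact/asboolP.
by apply/eqquotP; exact/asboolP.
Qed.

End isometry_classes.

Section local_GH_topology.
Variables (k : nat) (Xi : metricType R).

(* The two pointed spaces are related by a correspondence that matches the
   distinguished points, distorts distances and marks by at most e, and covers
   the balls of radius 1/e around the distinguished points on both sides.  For
   small e these relations form a base of entourages (the triangle inequality
   for e1 + e2 holds as soon as e1 + e2 <= 1). *)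
Definition GH_close (e : R) (x y : markedSpace k Xi) :=
  exists C : x -> y -> Prop,
  [/\ forall i, C (tnth (pts x) i) (tnth (pts y) i),
      forall u u', C u u' -> mdist (mark u) (mark u') <= e,
      forall u v u' v', C u u' -> C v v' ->
        `|mdist u v - mdist u' v'| <= e,
      forall i u, mdist (tnth (pts x) i) u <= e^-1 -> exists u', C u u' &
      forall i u', mdist (tnth (pts y) i) u' <= e^-1 -> exists u, C u u'].

Definition GH_open (U : set (isoClass k Xi)) :=
  forall x, U (cls x) ->
    exists2 e : R, 0 < e & forall y, GH_close e x y -> U (cls y).

Let GH_openT : GH_open setT.
Proof. by move=> x _; exists 1. Qed.

Let GH_close_le (e e' : R) x y : 0 < e -> e <= e' ->
  GH_close e x y -> GH_close e' x y.
Proof.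
move=> e0 ee' [C [C1 C2 C3 C4 C5]].
have eV : e'^-1 <= e^-1 by rewrite lef_pV2// posrE (lt_le_trans e0).
exists C; split => //.
- by move=> u u' /C2 /le_trans; apply.
- by move=> u v u' v' /C3 h /h /le_trans; apply.
- by move=> i u h; apply: (C4 i); exact: le_trans eV.
- by move=> i u h; apply: (C5 i); exact: le_trans eV.
Qed.

Let GH_openI U V : GH_open U -> GH_open V -> GH_open (U `&` V).
Proof.
move=> oU oV x [/oU[e e0 eU] /oV[e' e'0 eV]].
exists (Num.min e e'); first by rewrite lt_min e0.
have m0 : 0 < Num.min e e' by rewrite lt_min e0.
move=> y h; split.
- by apply: eU; apply: GH_close_le h => //; rewrite ge_min lexx.
- by apply: eV; apply: GH_close_le h => //; rewrite ge_min lexx orbT.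
Qed.

Let GH_open_bigcup (I : Type) (f : I -> set (isoClass k Xi)) :
  (forall i, GH_open (f i)) -> GH_open (\bigcup_i f i).
Proof.
move=> h x [i _ /h[e e0 he]]; exists e => // y /he fy; by exists i.
Qed.

HB.instance Definition _ := isOpenTopological.Build (isoClass k Xi)
  GH_openT GH_openI GH_open_bigcup.

End local_GH_topology.

End marked_spaces.

(* A one-point space of marks; spaces marked by it are the unmarked spaces. *)
Definition nomark (R : realType) : Type := unit.

HB.instance Definition _ (R : realType) := Choice.on (nomark R).

Section nomark_metric.
Variable R : realType.
Let d (x y : nomark R) : R := 0.
Let dxx x : d x x = 0. Proof. by []. Qed.
Let d_eq0 x y : d x y = 0 -> x = y. Proof. by case: x y => -[]. Qed.
Let d_sym x y : d x y = d y x. Proof. by []. Qed.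
Let d_triangle y x z : d x z <= d x y + d y z. Proof. by rewrite /d addr0. Qed.
HB.instance Definition _ := isMetric.Build R (nomark R) dxx d_eq0 d_sym d_triangle.
End nomark_metric.

Section random_discrete_spaces.
Context {R : realType}.

Let unit_triangle (y x z : unit) : 0 <= 0 + 0 :> R.
Proof. by rewrite addr0. Qed.

Let unit_eq0 (x y : unit) : 0 = 0 :> R -> x = y.
Proof. by case: x y => -[]. Qed.

Let unit_finite (v : unit) (r : R) : finite_set [set u : unit | 0 <= r].
Proof. by apply: (@sub_finite_set _ _ [set tt]); [case | exact: finite_set1]. Qed.

Definition one_point : discreteSpace R :=
  @DiscreteSpace R unit (fun _ _ => 0) (fun=> erefl) unit_eq0
    (fun _ _ => erefl) unit_triangle unit_finite.

HB.instance Definition _ (k : nat) :=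
  isPointed.Build (isoClass k (nomark R : metricType R))
    (cls (MarkedSpace (space := one_point) [tuple tt : one_point | _ < k]
       (fun=> tt : nomark R))).

(* [Dclass 1] is D_* and [Dclass 2] is D_**, with their Borel sigma-algebras. *)
Definition Dclass (k : nat) :=
  g_sigma_algebraType (@open (isoClass k (nomark R : metricType R))).

Definition pointed (D : discreteSpace R) (u : D) : Dclass 1 :=
  cls (MarkedSpace [tuple u] (fun=> tt : nomark R)).

Definition pointed2 (D : discreteSpace R) (u v : D) : Dclass 2 :=
  cls (MarkedSpace [tuple u; v] (fun=> tt : nomark R)).

(* A random pointed discrete space is represented by its law mu on D_*. *)
Definition unimodular (mu : probability (Dclass 1) R) :=
  forall g : Dclass 2 -> \bar R, measurable_fun setT g ->
    (forall a, 0 <= g a)%E ->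
    (\int[mu]_a (\esum_(v in [set: rep a]) g (pointed2 (origin (rep a)) v)) =
     \int[mu]_a (\esum_(v in [set: rep a]) g (pointed2 v (origin (rep a)))))%E.

(* The product sigma-algebra on the Xi-valued markings of D. *)
Definition marking_measurable (D : discreteSpace R) (Xi : metricType R)
    : set (set (D -> Xi)) :=
  <<s [set A | exists v (U : set Xi), open U /\ A = [set m | U (m v)]] >>.

Definition remark k (Xi Xi' : metricType R) (x : markedSpace k Xi)
    (m : x -> Xi') : markedSpace k Xi' := MarkedSpace (pts x) m.

(* The process on D is a random marking [process_mark D] defined on a
   probability space that may depend on D. *)
Record equivariantProcess (Xi : metricType R) := EquivariantProcess {
  process_display : measure_display ;
  process_space : discreteSpace R -> measurableType process_display ;
  process_prob : forall D, probability (process_space D) R ;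
  process_mark : forall D, process_space D -> D -> Xi ;
  process_measurable : forall D v (U : set Xi), open U ->
    measurable [set om | U (@process_mark D om v)] ;
  process_equivariant : forall (D1 D2 : discreteSpace R) (rho : D1 -> D2),
    isometry rho ->
    forall A, marking_measurable A ->
      process_prob D2 [set om | A (process_mark om \o rho)] =
      process_prob D1 [set om | A (process_mark om)] ;
  process_law_measurable : forall A : set (isoClass 1 Xi), <<s open >> A ->
    measurable_fun setT (fun a : Dclass 1 =>
      process_prob (rep a)
        [set om | A (cls (@remark 1 _ Xi (rep a) (process_mark om)))]) }.

Section sampling.
Variables (mu : probability (Dclass 1) R).
Variables (Xi : metricType R) (Z : equivariantProcess Xi).

(* [D, o; Z_D] for the representative (D, o) of a and the outcome om. *)
Definition sample (a : Dclass 1) (om : process_space Z (rep a)) :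
    markedSpace 1 Xi :=
  @remark 1 _ Xi (rep a) (process_mark om).

(* Expectation, probability and almost sure validity when [D, o] has law mu and
   then Z_D is sampled conditionally on D. *)
Definition expect (f : markedSpace 1 Xi -> \bar R) : \bar R :=
  (\int[mu]_a \int[process_prob Z (rep a)]_om f (sample om))%E.

Definition proba (A : markedSpace 1 Xi -> Prop) : \bar R :=
  (\int[mu]_a process_prob Z (rep a) [set om | A (sample om)])%E.

Definition almost_surely (A : markedSpace 1 Xi -> Prop) :=
  {ae mu, forall a, {ae process_prob Z (rep a), forall om, A (sample om)}}.

End sampling.

Definition nonneg_process (Z : equivariantProcess R^o) :=
  forall D om v, 0 <= @process_mark _ Z D om v.

(* w(S) for the weights given by the marks of x. *)
Definition weight (x : markedSpace 1 R^o) (S : set x) : \bar R :=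
  \esum_(v in S) (mark v : R)%:E.

(* [powR 0 0] is 1 in the library. *)
Definition pow00 (x a : R) : R := if x == 0 then 0 else x `^ a.

Section hausdorff.
Variable mu : probability (Dclass 1) R.

Definition equivariant_covering (Z : equivariantProcess R^o) :=
  nonneg_process Z /\
  almost_surely mu Z (fun x =>
    \bigcup_(v in [set: x]) cball (mark v : R) v = [set: x]).

Definition radii_ge (M : R) (Z : equivariantProcess R^o) :=
  almost_surely mu Z (fun x => forall v : x, mark v = 0 \/ M <= mark v).

Definition hausdorff_content (alpha M : R) : \bar R :=
  ereal_inf [set h | exists Z : equivariantProcess R^o,
    [/\ equivariant_covering Z, radii_ge M Z &
        h = expect mu Z (fun x => (pow00 (mark (origin x)) alpha)%:E)]].

(* The supremum is taken in [0, +oo], so the supremum of the empty set is 0. *)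
Definition udimH : \bar R :=
  maxe 0%E (ereal_sup [set alpha%:E | alpha in
    [set alpha | 0 <= alpha /\ hausdorff_content alpha 1 = 0%E]]).

End hausdorff.

End random_discrete_spaces.

(* Main.v *)
(* Let every point u send mass E[w(u)] * P[0 < R(v), d(u,v) <= R(v)] to every
   point v.  The weights and the radii enter only through their separate laws, so
   they need not be realized on a common probability space.  Since R is a
   covering, the mass sent by the origin is at least E[w(o)]; the mass received
   is E[W(R(o))] with W(r) = E[w(N_r(o))] <= c r ^ alpha, hence at most
   c E[R(o) ^ alpha].  Unimodularity gives (i).  For (ii), any beta > alpha also
   satisfies the growth condition, with M = 1 and a larger c, and a
   non-degenerate w has E[w(o)] > 0 by unimodularity. *)

Require Import Defs.
From HB Require Import structures.
From mathcomp Require Import all_boot all_order all_algebra.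
From mathcomp Require Import all_classical all_reals all_analysis.
From mathcomp Require Import measurable_realfun.
Set Implicit Arguments.
Unset Strict Implicit.
Unset Printing Implicit Defensive.
Import Order.TTheory GRing.Theory Num.Theory.
Import numFieldTopology.Exports numFieldNormedType.Exports.
Local Open Scope classical_set_scope.
Local Open Scope ring_scope.

(** * Almost everywhere comparison of integrals; preimages of Borel sets *)

Section measure_lemmas.
Local Open Scope ereal_scope.
Context d (T : measurableType d) (R : realType).
Import HBNNSimple.

(* No measurability is required: the integral of a nonnegative function is a
   supremum over the simple functions below it. *)
Lemma ae_le_integral (mu : {measure set T -> \bar R}) (f g : T -> \bar R) :
  (forall x, 0 <= f x) -> (forall x, 0 <= g x) ->
  {ae mu, forall x, f x <= g x} -> \int[mu]_x f x <= \int[mu]_x g x.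
Proof.
move=> f0 g0 [N [mN N0 fgN]]; rewrite ge0_integralTE//.
apply: ge_ereal_sup => _ [h /= hf <-].
have mNC : measurable (~` N) by exact: measurableC.
(* Cutting [h] off to 0 on the exceptional null set [N] keeps its integral and puts it below [g]
   everywhere. *)
pose h' : {nnsfun T >-> R} := proj_nnsfun h mNC.
have -> : sintegral mu h = sintegral mu h'.
  rewrite -!integralT_nnsfun; apply: ge0_ae_eq_integral => //.
  - exact/measurable_EFinP.
  - exact/measurable_EFinP.
  - by move=> x _; rewrite lee_fin.
  - by move=> x _; rewrite lee_fin.
  - exists N; split=> // x /= /not_implyP[_]; apply: contra_notP => Nx.
    by rewrite /h' /= mindicE mem_set//= mulr1.
rewrite (ge0_integralTE _ g0); apply: ereal_sup_ubound; exists h' => //= x.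
rewrite /h' /= mindicE; have [xN|xN] := boolP (x \in ~` N); last first.
  by rewrite mulr0.
rewrite mulr1; apply: (le_trans (hf x)); apply: contrapT => fg.
by move: xN; rewrite inE; apply; exact: fgN.
Qed.

(** The sets whose preimage lies in [G] form a sigma-algebra, and open intervals generate the Borel
    sets. As [G] is a bare family of sets, it can be the Borel sets of isometry classes, the events
    of a process or the sigma-algebra of markings. *)
Lemma sigma_algebra_preimage_measurable (S : Type) (G : set (set S))
    (f : S -> R) : sigma_algebra setT G ->
  (forall U : set R, open U -> G (f @^-1` U)) ->
  forall B : set R, measurable B -> G (f @^-1` B).
Proof.
move=> [G0 GC GU] fG; have -> : @measurable _ R = <<s @RGenOpens.G R >>.
  exact: RGenOpens.measurableE.
change (<<s @RGenOpens.G R >> `<=` [set B | G (f @^-1` B)]).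
apply: smallest_sub; first split => /=.
- by rewrite preimage_set0.
- by move=> A GA; rewrite setTD preimage_setC -setTD; exact: GC.
- by move=> F GF; rewrite preimage_bigcup; exact: GU.
- by move=> _ [x [y ->]]; apply: fG; exact: interval_open.
Qed.
End measure_lemmas.

(** * Exhaustion of a discrete space by balls *)

Section discrete_space_lemmas.
Context {R : realType}.
Implicit Types D : discreteSpace R.

(** Together with [finite_balls] this exhausts the space by finite sets, so that events about all
    points become countable unions. *)
Lemma bigcup_dist_balls D (v : D) :
  \bigcup_n [set u | mdist v u <= n%:R] = [set: D].
Proof.
apply/seteqP; split=> // u _; exists (Num.bound (mdist v u)) => //=.
by apply: ltW; apply: archi_boundP; exact: mdist_ge0.
Qed.

Lemma nondecreasing_dist_balls D (v : D) :
  nondecreasing_seq (fun n => [set u | mdist v u <= n%:R :> R]).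
Proof.
move=> m n mn; apply/subsetPset => u /= /le_trans; apply.
by rewrite ler_nat.
Qed.

Lemma isometry_id D : Defs.isometry (@id D).
Proof. by split=> //; exists id. Qed.

Lemma open_isoClass k (Xi : metricType R) (U : set (isoClass k Xi)) :
  GH_open U -> open U.
Proof. exact. Qed.

End discrete_space_lemmas.

(** * Functions on isometry classes and their measurability *)

Section isoClass_maps.
Context {R : realType}.

Lemma rep_isometric k (Xi : metricType R) (x : markedSpace k Xi) :
  marked_isometric (rep (cls x)) x.
Proof. by apply/clsP; rewrite repK. Qed.

Lemma mark_origin_rep k (Xi : metricType R) (x : markedSpace k.+1 Xi) :
  mark (origin (rep (cls x))) = mark (origin x).
Proof. by have [rho [_ rp <-]] := rep_isometric x; rewrite /origin rp. Qed.

Lemma GH_open_mark_origin k (Xi : metricType R) (U : set Xi) : open U ->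
  GH_open [set b : isoClass k.+1 Xi | U (mark (origin (rep b)))].
Proof.
move=> oU x /=; rewrite mark_origin_rep => Ux.
have /nbhs_ballP[e /= e0 eU] : nbhs (mark (origin x)) U by exact: open_nbhs_nbhs.
(* Closeness bounds the distance of the marks only non-strictly, while the ball of radius [e] is
   open; hence the half. *)
exists (e / 2); first exact: divr_gt0.
move=> y [C [C1 C2 _ _ _]]; rewrite mark_origin_rep; apply: eU.
rewrite ballEmdist /=.
by apply: (le_lt_trans (C2 _ _ (C1 ord0))); rewrite ltr_pdivrMr// ltr_pMr// ltr1n.
Qed.

(** Pulls functions of one point back to [Dclass 2], where transports live. *)
Definition nth_pointed k (b : @Dclass R k) (i : 'I_k) : @Dclass R 1 :=
  pointed (tnth (pts (rep b)) i).

Lemma nth_pointed_cls k (x : markedSpace k (nomark R)) i :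
  nth_pointed (cls x : Dclass k) i = pointed (tnth (pts x) i).
Proof.
have [rho [rd rp _]] := rep_isometric x.
by apply/clsP; exists rho; split=> // j; rewrite (ord1 j) !tnth0 rp.
Qed.

(** The projection is continuous: a correspondence adapted to all [k] points is, with the same [e],
    adapted to the [i]-th alone. *)
Lemma measurable_nth_pointed k (i : 'I_k) :
  measurable_fun setT (fun b : @Dclass R k => nth_pointed b i).
Proof.
apply: (@measurability _ _ (@Dclass R k) (@Dclass R 1) setT _
  (@open (isoClass 1 (nomark R : metricType R)))) => //.
move=> _ [U oU <-]; rewrite setTI; apply: sub_sigma_algebra.
apply: open_isoClass => x /=; rewrite nth_pointed_cls => Ux.
have [e e0 eU] := (oU : GH_open U) _ Ux.
exists e => // y [C [C1 C2 C3 C4 C5]]; rewrite /= nth_pointed_cls; apply: eU.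
exists C; split=> //.
- by move=> j; rewrite (ord1 j) !tnth0.
- by move=> j; rewrite (ord1 j) tnth0; exact: C4.
- by move=> j; rewrite (ord1 j) tnth0; exact: C5.
Qed.

Definition pts_dist (b : @Dclass R 2) : R :=
  mdist (tnth (pts (rep b)) ord0) (tnth (pts (rep b)) ord_max).

Lemma pts_dist_cls (x : markedSpace 2 (nomark R)) :
  pts_dist (cls x) = mdist (tnth (pts x) ord0) (tnth (pts x) ord_max).
Proof. by have [rho [[_ rd] rp _]] := rep_isometric x; rewrite -!rp rd. Qed.

Lemma measurable_pts_dist : measurable_fun setT pts_dist.
Proof.
move=> _ B mB; rewrite setTI.
apply: (sigma_algebra_preimage_measurable (G := <<s open >>)) mB.
  exact: smallest_sigma_algebra.
move=> U oU; apply: sub_sigma_algebra.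
apply: open_isoClass => x /=; rewrite pts_dist_cls => Ux.
have /nbhs_ballP[e /= e0 eU] := open_nbhs_nbhs (conj oU Ux).
exists (e / 2); first exact: divr_gt0.
move=> y [C [C1 _ C3 _ _]]; rewrite /= pts_dist_cls; apply: eU.
rewrite /ball /= (le_lt_trans (C3 _ _ _ _ (C1 ord0) (C1 ord_max)))//.
by rewrite ltr_pdivrMr// ltr_pMr// ltr1n.
Qed.

End isoClass_maps.

(** * The law of a single mark as a kernel on [Dclass 1] *)

Section process_marks.
Local Open Scope ereal_scope.
Context {R : realType}.
Variable Z : equivariantProcess (R^o : metricType R).
Implicit Types (D : discreteSpace R) (a : @Dclass R 1).

Definition mark_at D (v : D) : process_space Z D -> R :=
  fun om => process_mark om v.

Lemma measurable_mark_at D (v : D) : measurable_fun setT (mark_at v).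
Proof.
move=> _ B mB; rewrite setTI.
apply: (sigma_algebra_preimage_measurable (G := measurable)) mB.
  split=> // [A mA|F mF]; first exact: measurableD.
  exact: bigcupT_measurable.
by move=> U oU; apply: process_measurable.
Qed.

HB.instance Definition _ D (v : D) :=
  isMeasurableFun.Build _ _ _ _ (mark_at v) (measurable_mark_at v).

Lemma mark_at_isometry D1 D2 (rho : D1 -> D2) (v : D1) (B : set R) :
  Defs.isometry rho -> measurable B ->
  process_prob Z D2 (mark_at (rho v) @^-1` B) =
  process_prob Z D1 (mark_at v @^-1` B).
Proof.
move=> rho_iso mB.
have := process_equivariant Z rho_iso (A := [set m | B (m v)]); apply.
apply: (sigma_algebra_preimage_measurable
  (G := @marking_measurable R D1 (R^o : metricType R))
  (f := fun m : D1 -> R^o => m v)) mB.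
  exact: smallest_sigma_algebra.
by move=> U oU; apply: sub_sigma_algebra; exists v, U.
Qed.

Definition mark_law a : {measure set R -> \bar R} :=
  distribution (process_prob Z (rep a)) (mark_at (origin (rep a))).

(** A Borel event about the mark of the origin is a Borel set of marked isometry classes, to which
    [process_law_measurable] applies. *)
Lemma measurable_mark_law (B : set R) : measurable B ->
  measurable_fun setT (mark_law ^~ B).
Proof.
move=> mB.
pose f (b : isoClass 1 (R^o : metricType R)) : R := mark (origin (rep b)).
have fB : <<s open >> (f @^-1` B).
  apply: (sigma_algebra_preimage_measurable (f := f)) mB.
    exact: smallest_sigma_algebra.
  move=> U oU; apply: sub_sigma_algebra.
  exact/open_isoClass/(GH_open_mark_origin (Xi := R^o : metricType R) oU).
have := process_law_measurable Z fB.
congr (measurable_fun _ _); apply/funext => a.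
rewrite /mark_law /= /distribution /pushforward; congr (process_prob _ _ _).
by apply/funext => om /=; rewrite /f mark_origin_rep.
Qed.

HB.instance Definition _ :=
  isKernel.Build _ _ _ _ _ mark_law measurable_mark_law.

Lemma mark_lawT a : mark_law a [set: R] = 1.
Proof. exact: probability_setT. Qed.

HB.instance Definition _ :=
  Kernel_isProbability.Build _ _ _ _ _ mark_law mark_lawT.

(** By equivariance the law can be computed in [D] itself instead of the chosen representative,
    which is isometric to it. *)
Lemma mark_law_pointed D (v : D) (B : set R) : measurable B ->
  mark_law (pointed v) B = process_prob Z D (mark_at v @^-1` B).
Proof.
move=> mB; have [rho [rho_iso rp _]] :=
  rep_isometric (MarkedSpace [tuple v] (fun=> tt : nomark R)).
have := mark_at_isometry (origin (rep (pointed v))) rho_iso mB.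
by rewrite /origin rp tnth0 => /esym.
Qed.

Lemma ge0_integral_mark_law_pointed D (v : D) (f : R -> \bar R) :
  measurable_fun setT f -> (forall r, 0 <= f r) ->
  \int[mark_law (pointed v)]_r f r = \int[process_prob Z D]_om f (mark_at v om).
Proof.
move=> mf f0; rewrite -(ge0_integral_distribution (mark_at v) mf f0).
by apply: eq_measure_integral => B mB _; exact: mark_law_pointed.
Qed.

Lemma ge0_integral_mark_law a (f : R -> \bar R) :
  measurable_fun setT f -> (forall r, 0 <= f r) ->
  \int[mark_law a]_r f r =
  \int[process_prob Z (rep a)]_om f (mark_at (origin (rep a)) om).
Proof. exact: ge0_integral_distribution. Qed.

Lemma measurable_integral_mark_law (f : R -> \bar R) :
  measurable_fun setT f -> (forall r, 0 <= f r) ->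
  measurable_fun setT (fun a => \int[mark_law a]_r f r).
Proof. move=> mf f0; apply: measurable_fun_integral_kernel => //.
exact: measurable_mark_law. Qed.

(* The marks of interest are nonnegative; the absolute value makes the integrand
   nonnegative on all of [R]. *)
Definition mean_mark a : \bar R := \int[mark_law a]_r `|r|%:E.

Lemma mean_mark_ge0 a : 0 <= mean_mark a.
Proof. by apply: integral_ge0 => r _; rewrite lee_fin. Qed.

Lemma measurable_mean_mark : measurable_fun setT mean_mark.
Proof.
apply: (measurable_integral_mark_law (f := fun r => `|r|%:E)) => //.
by apply/measurable_EFinP; exact: normr_measurable.
Qed.

(** The radii with which a ball covers a point at distance [t] from its centre; [0 < r] reflects
    that radius 0 means no ball. *)
Definition reach_set (t : R) : set R := [set r | 0 < r /\ t <= r]%R.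

Lemma measurable_reach_set t : measurable (reach_set t).
Proof.
rewrite (_ : reach_set t = `]0%R, +oo[ `&` `[t, +oo[); last first.
  by apply/seteqP; split=> r /=; rewrite !in_itv/= !andbT.
exact: measurableI.
Qed.

(* [mark_law] is pulled back to D_** so that the finite-kernel lemma yields
   measurability in the points and their distance jointly. *)
Definition end_law (b : @Dclass R 2) : {measure set R -> \bar R} :=
  mark_law (nth_pointed b ord_max).

Lemma measurable_end_law (B : set R) : measurable B ->
  measurable_fun setT (end_law ^~ B).
Proof.
move=> mB; apply: (measurableT_comp (measurable_mark_law mB)).
exact: measurable_nth_pointed.
Qed.

HB.instance Definition _ :=
  isKernel.Build _ _ _ _ _ end_law measurable_end_law.

Lemma end_lawT b : end_law b [set: R] = 1.
Proof. exact: mark_lawT. Qed.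

HB.instance Definition _ :=
  Kernel_isProbability.Build _ _ _ _ _ end_law end_lawT.

(** The probability that the ball centred at the second point covers the first. *)
Definition reach_prob (b : @Dclass R 2) : \bar R :=
  end_law b (reach_set (pts_dist b)).

(** The reach sets are the sections of one measurable set of pairs [(b, r)], and a finite kernel
    measures such sections measurably. *)
Lemma measurable_reach_prob : measurable_fun setT reach_prob.
Proof.
pose A : set (@Dclass R 2 * R) := [set p | reach_set (pts_dist p.1) p.2].
have mA : measurable A.
  have -> : A = (snd @^-1` `]0%R, +oo[) `&`
      ((fun p => p.2 - pts_dist p.1)%R @^-1` `[0%R, +oo[).
    by apply/seteqP; split=> p; rewrite /A/= !in_itv/= !andbT subr_ge0.
  have msnd : measurable_fun setT (@snd (@Dclass R 2) R) by [].
  have mdiff : measurable_fun setT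
      (fun p : @Dclass R 2 * R => p.2 - pts_dist p.1)%R.
    apply: measurable_funB => //.
    by apply: (measurableT_comp measurable_pts_dist).
  apply: measurableI; rewrite -[X in measurable X]setTI; first exact: msnd.
  exact: mdiff.
have := @measurable_fun_xsection_finite_kernel _ _ _ _ R end_law A (mem_set mA).
congr (measurable_fun _ _); apply/funext => b; congr (end_law b _).
by apply/seteqP; split=> r; rewrite /xsection /= inE.
Qed.

Lemma reach_prob_pointed2 D (u v : D) :
  reach_prob (pointed2 u v) =
  process_prob Z D (mark_at v @^-1` (reach_set (mdist u v))).
Proof.
rewrite /reach_prob /end_law /pointed2 nth_pointed_cls pts_dist_cls.
rewrite !(tnth_nth u)/=. apply: mark_law_pointed; exact: measurable_reach_set.
Qed.

End process_marks.

(** * Mass sent and mass received in a fixed space *)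

Section fixed_space.
Local Open Scope ereal_scope.
Context {R : realType}.
Variable D : discreteSpace R.
Implicit Types w Z : equivariantProcess (R^o : metricType R).

Lemma mean_mark_pointed Z (v : D) :
  mean_mark Z (pointed v) = \int[process_prob Z D]_om `|mark_at v om|%:E.
Proof.
rewrite /mean_mark (@ge0_integral_mark_law_pointed _ _ _ _ (fun r => `|r|%:E))//.
by apply/measurable_EFinP; exact: normr_measurable.
Qed.

(** Almost surely some ball covers [o], so the covering probabilities sum to at least 1.
    Subadditivity is used on finite balls around [o], followed by a limit in which [e] can be
    factored out because it is finite. *)
Lemma covering_total_mass Z (o : D) (e : \bar R) : 0 <= e -> e \is a fin_num ->
  {ae process_prob Z D, forall om, \bigcup_(v in [set: D])
    cball (mark_at v om) v = [set: D]} ->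
  e <= \esum_(v in [set: D])
         e * process_prob Z D (mark_at v @^-1` (reach_set (mdist o v))).
Proof.
move=> e0 efin cov; set P := process_prob Z D.
pose A v : set (process_space Z D) := mark_at v @^-1` (reach_set (mdist o v)).
have mA v : measurable (A v).
  by rewrite -[X in measurable X]setTI; apply: measurable_mark_at => //;
    exact: measurable_reach_set.
(* [F n] is the event that [o] is covered by a ball centred within distance [n]. *)
pose F n := \bigcup_(v in [set u | (mdist o u <= n%:R)%R]) A v.
have mF n : measurable (F n).
  by apply: fin_bigcup_measurable => //; exact: finite_balls.
have mUF : measurable (\bigcup_n F n) by exact: bigcupT_measurable.
have PF1 : P (\bigcup_n F n) = 1.
  rewrite -[\bigcup_n F n]setCK probability_setC; last exact: measurableC.
  rewrite [X in 1 - X](_ : _ = 0) ?sube0//; apply/negligibleP.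
    exact: measurableC.
  apply: negligibleS cov => om /= NF.
  apply: contra_not NF => cov.
  have : [set: D] o by [].
  rewrite -cov => -[v _ [r0 vo]].
  have : [set: D] v by [].
  rewrite -(bigcup_dist_balls o) => -[n _ /= on].
  by exists n => //; exists v => //; split=> //; rewrite metric_sym.
have ndF : nondecreasing_seq F.
  move=> m n mn; apply/subsetPset; apply: bigcup_subset.
  by apply/subsetPset; exact: nondecreasing_dist_balls.
have PFcvg : e * P (F n) @[n --> \oo] --> e.
  rewrite -[X in _ --> X]mule1 -PF1; apply: cvgeZl => //.
  exact: nondecreasing_cvg_mu.
rewrite -[leLHS](cvg_lim _ PFcvg)//; apply: lime_le.
  by apply/cvg_ex; exists e.
apply: nearW => n; apply: esum_ge; exists [set u | (mdist o u <= n%:R)%R].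
  by split=> //; exact: finite_balls.
rewrite -ge0_mule_fsumr; last by move=> v; exact: measure_ge0.
rewrite lee_wpmul2l//; apply: (content_sub_fsum _ (A_ := A)) => //.
exact: finite_balls.
Qed.

(** The almost sure bound is integrated after exchanging a finite sum with the integral. Finite
    subsets suffice for later use, since [esum] is the supremum of its finite partial sums. *)
Lemma mean_ball_mass w (o : D) (S : set D) (r m : R) :
  nonneg_process w -> (0 <= m)%R ->
  {ae process_prob w D, forall om,
    \esum_(v in cball r o) (mark_at v om)%:E <= m%:E} ->
  finite_set S -> S `<=` cball r o ->
  \sum_(v \in S) mean_mark w (pointed v) <= m%:E.
Proof.
move=> w0 m0 wm finS Sr; under eq_fsbigr do rewrite mean_mark_pointed.
rewrite -ge0_integral_fsum//.
- rewrite -[leRHS]mule1 -(probability_setT (process_prob w D)).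
  rewrite -integral_cst//; apply: ae_le_integral => //.
  + by move=> om; apply: fsume_ge0 => v _; rewrite lee_fin.
  + apply: filterS wm => om /=; apply: le_trans.
    apply: esum_ge; exists S => //.
    by apply: lee_fsum => // v _; rewrite ger0_norm//; exact: w0.
by move=> v; apply/measurable_EFinP; exact: measurableT_comp.
Qed.

(** As [r] is positive, [o] lies in its own ball, so its mean weight is at most [m]. This supplies
    the finite [e] of [covering_total_mass]. *)
Lemma mean_mark_fin_num w (o : D) (r m : R) :
  nonneg_process w -> (0 <= m)%R -> (0 < r)%R ->
  {ae process_prob w D, forall om,
    \esum_(v in cball r o) (mark_at v om)%:E <= m%:E} ->
  mean_mark w (pointed o) \is a fin_num.
Proof.
move=> w0 m0 r0 wm; rewrite ge0_fin_numE; last exact: mean_mark_ge0.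
apply: le_lt_trans (ltry m).
have := mean_ball_mass w0 m0 wm (finite_set1 o); rewrite fsbig_set1; apply.
by move=> _ ->; split=> //; rewrite mdistxx ltW.
Qed.

Lemma pow00E (x a : R) : a != 0%R -> pow00 x a = (x `^ a)%R.
Proof. by move=> a0; rewrite /pow00; case: eqP => // ->; rewrite powR0. Qed.

(** Fix the radius of the ball at [o]: the senders are the points of that ball, and their total mean
    weight is controlled by the growth bound at this radius. Integrating over the radius gives the
    claim. *)
Lemma growth_total_mass w Z (o : D) (c alpha M : R) :
  (0 < M)%R -> (0 < alpha)%R -> (0 < c)%R -> nonneg_process w ->
  {ae process_prob w D, forall om, forall r, (M <= r)%R ->
    \esum_(v in cball r o) (mark_at v om)%:E <= (c * r `^ alpha)%:E} ->
  {ae process_prob Z D, forall om,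
    mark_at o om = 0%R \/ (M <= mark_at o om)%R} ->
  \esum_(v in [set: D]) mean_mark w (pointed v) *
      process_prob Z D (mark_at o @^-1` (reach_set (mdist v o))) <=
  c%:E * \int[process_prob Z D]_om (pow00 (mark_at o om) alpha)%:E.
Proof.
move=> M0 al0 c0 w0 wgrow ZM; set P := process_prob Z D.
pose A v : set (process_space Z D) := mark_at o @^-1` (reach_set (mdist v o)).
have mA v : measurable (A v).
  by rewrite -[X in measurable X]setTI; apply: measurable_mark_at => //;
    exact: measurable_reach_set.
have mpow : measurable_fun setT
    (fun om => (pow00 (mark_at (Z := Z) o om) alpha)%:E).
  apply/measurable_EFinP; under eq_fun do rewrite pow00E ?gt_eqF//.
  exact: (measurableT_comp (measurable_powR alpha) (measurable_mark_at o)).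
apply: ge_ereal_sup => _ [S [finS _] <-].
have termE v : mean_mark w (pointed v) * P (A v) =
    \int[P]_om (mean_mark w (pointed v) * (\1_(A v) om)%:E).
  rewrite ge0_integralZl ?mean_mark_ge0//.
    by rewrite integral_indic// setIT.
  by apply/measurable_EFinP; apply: measurable_indic; exact: mA.
under eq_fsbigr do rewrite termE.
have pow0 x : 0 <= (pow00 x alpha)%:E.
  by rewrite lee_fin pow00E ?gt_eqF// powR_ge0.
have ind0 v om : 0 <= mean_mark w (pointed v) * (\1_(A v) om)%:E.
  by rewrite mule_ge0 ?mean_mark_ge0// lee_fin.
rewrite -ge0_integral_fsum//; last first.
  move=> v; apply: emeasurable_funM => //.
  by apply/measurable_EFinP; apply: measurable_indic; exact: mA.
rewrite -ge0_integralZl//; last by rewrite lee_fin ltW.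
apply: ae_le_integral => //.
- by move=> om; apply: fsume_ge0 => v _.
- by move=> om; rewrite mule_ge0// lee_fin ltW.
(* Radius 0 gives an empty ball and [o] receives nothing; otherwise the radius is at least [M],
   where the growth bound is available. *)
apply: filterS ZM => om /= [Z0|MZ].
  rewrite fsbig1; first by rewrite mule_ge0// lee_fin ltW.
  move=> v _; rewrite indicE memNset ?mule0// /A /= /reach_set /= Z0.
  by rewrite ltxx => -[].
rewrite (_ : \sum_(_ \in _) _ =
    \sum_(v \in S `&` cball (mark_at o om) o) mean_mark w (pointed v)).
  rewrite -EFinM pow00E ?gt_eqF//.
  apply: (@mean_ball_mass w o _ (mark_at o om)) => //.
  - by rewrite mulr_ge0 ?powR_ge0// ltW.
  - by apply: filterS wgrow => om'; exact.
  - exact: finite_setIl.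
rewrite fsbig_mkcondr; apply: eq_fsbigr => v _; rewrite indicE.
have -> : (om \in A v) = (v \in cball (mark_at o om) o).
  by apply: asbool_equiv_eq; rewrite /A /reach_set /cball /= metric_sym.
by case: ifP; rewrite ?mule1 ?mule0.
Qed.

End fixed_space.

(** * Mean weights at the origin and the transport function *)

Section random_space.
Local Open Scope ereal_scope.
Context {R : realType}.
Implicit Types (a : @Dclass R 1) (w Z : equivariantProcess (R^o : metricType R)).

Lemma pointed_origin a : pointed (origin (rep a)) = a.
Proof.
rewrite -[RHS]repK; apply/clsP; exists id; split=> //.
- exact: isometry_id.
- by move=> i; rewrite (ord1 i) tnth0.
- by move=> v; case: (mark v); case: (mark _).
Qed.

Lemma mean_mark_origin Z a : nonneg_process Z ->
  mean_mark Z a =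
  \int[process_prob Z (rep a)]_om (mark_at (origin (rep a)) om)%:E.
Proof.
move=> Z0; rewrite -{1}[a]pointed_origin mean_mark_pointed.
by apply: eq_integral => om _; rewrite ger0_norm//; exact: Z0.
Qed.

(** Each mark vanishes almost surely, and the exhaustion by finite balls around [o] reduces the
    claim to a countable union of null events. *)
Lemma mean_mark_pointed_eq0 Z (D : discreteSpace R) (o : D) :
  (forall v : D, mean_mark Z (pointed v) = 0) ->
  process_prob Z D [set om | exists v, mark_at v om <> 0%R] = 0.
Proof.
move=> mean0; set P := process_prob Z D.
pose A v : set (process_space Z D) := mark_at v @^-1` [set~ 0%R].
have mA v : measurable (A v).
  by rewrite -[X in measurable X]setTI; apply: measurable_mark_at => //;
    exact: measurableC.
have A0 v : P (A v) = 0.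
  apply/negligibleP; first exact: mA.
  have : \int[P]_om `|(mark_at v om)%:E| = 0.
    by rewrite -(mean0 v) mean_mark_pointed.
  move/ae_eq_integral_abs => /(_ measurableT).
  case; first exact/measurable_EFinP.
  move=> N [mN N0 sN]; exists N; split=> // om Aom; apply: sN => /=.
  by apply/not_implyP; split=> // -[].
pose F n := \bigcup_(v in [set u | (mdist o u <= n%:R)%R]) A v.
have -> : [set om | exists v, mark_at v om <> 0%R] = \bigcup_n F n.
  apply/seteqP; split=> [om [v vom]|om [n _ [v _ Av]]]; last by exists v.
  have : [set: D] v by [].
  by rewrite -(bigcup_dist_balls o) => -[n _ ?]; exists n => //; exists v.
have mF n : measurable (F n).
  by apply: fin_bigcup_measurable => //; exact: finite_balls.
apply/negligibleP; first exact: bigcupT_measurable.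
apply: negligible_bigcup => n; apply/negligibleP => //.
apply/eqP; rewrite -measure_le0.
apply: (@le_trans _ _ (\sum_(v \in [set u | (mdist o u <= n%:R)%R]) P (A v))).
  by apply: (content_sub_fsum _ (A_ := A)) => //; exact: finite_balls.
by rewrite fsbig1.
Qed.

(** The first point sends; the second receives and is the centre of the covering ball. *)
Definition ball_transport w Z (b : @Dclass R 2) : \bar R :=
  mean_mark w (nth_pointed b ord0) * reach_prob Z b.

Lemma ball_transport_ge0 w Z b : 0 <= ball_transport w Z b.
Proof. by rewrite mule_ge0 ?mean_mark_ge0. Qed.

Lemma measurable_ball_transport w Z : measurable_fun setT (ball_transport w Z).
Proof.
apply: emeasurable_funM; last exact: measurable_reach_prob.
by apply: (measurableT_comp (measurable_mean_mark w));
  exact: measurable_nth_pointed.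
Qed.

Lemma ball_transport_pointed2 w Z (D : discreteSpace R) (u v : D) :
  ball_transport w Z (pointed2 u v) = mean_mark w (pointed u) *
    process_prob Z D (mark_at v @^-1` (reach_set (mdist u v))).
Proof.
by rewrite /ball_transport reach_prob_pointed2 /pointed2 nth_pointed_cls.
Qed.

End random_space.

(** * Applications of the mass transport principle *)

Section unimodular_space.
Local Open Scope ereal_scope.
Context {R : realType} (mu : probability (@Dclass R 1) R).
Hypothesis mu_unimodular : unimodular mu.
Implicit Types (a : @Dclass R 1) (w Z : equivariantProcess (R^o : metricType R)).

Definition ball_growth w (c alpha M : R) :=
  almost_surely mu w (fun x : markedSpace 1 R^o => forall r : R, (M <= r)%R ->
    weight (cball r (origin x)) <= (c * r `^ alpha)%:E).

Lemma expect_mark_origin Z : nonneg_process Z ->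
  expect mu Z (fun x => (mark (origin x) : R)%:E) = \int[mu]_a mean_mark Z a.
Proof.
by move=> Z0; apply: eq_integral => a _; rewrite mean_mark_origin.
Qed.

Lemma expect_weight_le w Z (c alpha M : R) :
  (0 < c)%R -> (0 < alpha)%R -> (0 < M)%R -> nonneg_process w ->
  ball_growth w c alpha M -> equivariant_covering mu Z -> radii_ge mu M Z ->
  expect mu w (fun x => (mark (origin x) : R)%:E) <=
  c%:E * expect mu Z (fun x => (pow00 (mark (origin x)) alpha)%:E).
Proof.
move=> c0 al0 M0 w0 wgrow [Z0 Zcov] ZM.
rewrite /ball_growth /almost_surely in wgrow Zcov; rewrite /radii_ge /almost_surely in ZM.
have pow_ge0 (x : R) : 0 <= (pow00 x alpha)%:E.
  by rewrite lee_fin pow00E ?gt_eqF// powR_ge0.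
have mpow : measurable_fun setT (fun x : R => (pow00 x alpha)%:E).
  apply/measurable_EFinP; under eq_fun do rewrite pow00E ?gt_eqF//.
  exact: measurable_powR.
have Fmu : Filter (almost_everywhere mu) by exact: ae_filter_ringOfSetsType.
have cM0 : (0 <= c * M `^ alpha)%R by rewrite mulr_ge0 ?powR_ge0// ltW.
rewrite expect_mark_origin//.
apply: (@le_trans _ _ (\int[mu]_a \esum_(v in [set: rep a])
    ball_transport w Z (pointed2 (origin (rep a)) v))).
  apply: ae_le_integral.
  - by move=> a; exact: mean_mark_ge0.
  - by move=> a; apply: esum_ge0 => v _; exact: ball_transport_ge0.
  - apply: filterS2 wgrow Zcov => a wa Za.
    (* The growth bound at the single radius [M] already makes the mean weight finite. *)
    have efin : mean_mark w (pointed (origin (rep a))) \is a fin_num.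
      apply: (mean_mark_fin_num w0 cM0 M0).
      by apply: filterS wa => om /(_ M (lexx M)).
    under eq_esum do rewrite ball_transport_pointed2.
    rewrite -{1}(pointed_origin a).
    exact: (covering_total_mass _ (mean_mark_ge0 _ _) efin Za).
(* After this exchange the origin is the receiver, and [growth_total_mass] applies. *)
rewrite (mu_unimodular (measurable_ball_transport w Z) (ball_transport_ge0 w Z)).
rewrite /expect -ge0_integralZl//.
- apply: ae_le_integral.
  + by move=> a; apply: esum_ge0 => v _; exact: ball_transport_ge0.
  + move=> a; rewrite mule_ge0// ?lee_fin ?(ltW c0)//.
    by apply: integral_ge0 => om _.
  + apply: filterS2 wgrow ZM => a wa Za.
    under eq_esum do rewrite ball_transport_pointed2.
    apply: (@growth_total_mass _ _ w Z (origin (rep a)) c alpha M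
      M0 al0 c0 w0 wa).
    apply: filterS Za => om Zom; exact: (Zom (origin (rep a))).
- have := measurable_integral_mark_law Z mpow pow_ge0.
  congr (measurable_fun _ _); apply/funext => a.
  exact: ge0_integral_mark_law.
- by move=> a _; apply: integral_ge0 => om _.
- by rewrite lee_fin ltW.
Qed.

Lemma expect_weight_le_content w (c alpha M : R) :
  (0 < c)%R -> (0 < alpha)%R -> (0 < M)%R -> nonneg_process w ->
  ball_growth w c alpha M ->
  (c^-1)%:E * expect mu w (fun x => (mark (origin x) : R)%:E) <=
  hausdorff_content mu alpha M.
Proof.
move=> c0 al0 M0 w0 wgrow; apply: le_ereal_inf_tmp => _ [Z [Zcov ZM ->]].
rewrite lee_pdivrMl//; exact: expect_weight_le Zcov ZM.
Qed.

(* Every point of positive mean weight sends infinite mass to every point: if the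
   origin has mean weight 0 a.s. then no mass is sent, hence none is received. *)
Lemma expect_weight_gt0 w : nonneg_process w ->
  0 < proba mu w (fun x => exists v : x, mark v <> 0%R :> R) ->
  0 < expect mu w (fun x => (mark (origin x) : R)%:E).
Proof.
move=> w0; apply: contraTT; rewrite -!leNgt expect_mark_origin// => wle0.
have mean0 : ae_eq mu setT (mean_mark w) (cst 0).
  apply/ae_eq_integral_abs => //; first exact: measurable_mean_mark.
  under eq_integral do rewrite gee0_abs ?mean_mark_ge0//.
  apply/eqP; rewrite eq_le wle0 integral_ge0// => a _; exact: mean_mark_ge0.
(* With the convention [+oo * 0 = 0], points of mean weight 0 send nothing. *)
pose g (b : @Dclass R 2) := +oo * mean_mark w (nth_pointed b ord0).
have g0 b : 0 <= g b by rewrite mule_ge0 ?mean_mark_ge0.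
have gE (D : discreteSpace R) (u v : D) :
    g (pointed2 u v) = +oo * mean_mark w (pointed u).
  by rewrite /g /pointed2 nth_pointed_cls.
apply: (@le_trans _ _ (\int[mu]_a \esum_(v in [set: rep a])
    g (pointed2 v (origin (rep a))))).
  apply: ae_le_integral.
  - by move=> a; exact: measure_ge0.
  - by move=> a; exact: esum_ge0.
  - apply: aeW => a.
    (* Either all mean weights vanish and the probability is 0, or the origin receives [+oo], which
       bounds any probability. *)
    have [allv|] := pselect (forall v : rep a, mean_mark w (pointed v) = 0).
      by rewrite (mean_mark_pointed_eq0 (origin (rep a)) allv) esum_ge0.
    move=> /existsNP[v mv]; rewrite (@le_trans _ _ +oo) ?leey//.
    apply: esum_ge; exists [set v]; first by split=> //; exact: finite_set1.
    rewrite fsbig_set1 gE gt0_mulye//.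
    by rewrite lt0e mean_mark_ge0 andbT; exact/eqP.
have mg : measurable_fun setT g.
  apply: measurable_funeM; apply: (measurableT_comp (measurable_mean_mark w)).
  exact: measurable_nth_pointed.
rewrite -(mu_unimodular mg g0) -[leRHS](integral0 mu setT) {mg}.
apply: ae_le_integral => //.
- by move=> a; exact: esum_ge0.
- apply: filterS mean0 => a /(_ Logic.I) /= a0.
  by rewrite esum1// => v _; rewrite gE pointed_origin a0 mule0.
Qed.

End unimodular_space.

(** * Change of exponent and the dimension bound *)

Lemma weight_cball_le (R : realType) (x : markedSpace 1 R^o) (o : x) (r s : R) :
  r <= s -> (weight (cball r o) <= weight (cball s o))%E.
Proof.
move=> rs; apply: ge_ereal_sup => _ [S [finS Sr] <-].
apply: esum_ge; exists S => //; split=> // v /Sr[r0 vr].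
by split; [exact: lt_le_trans rs|exact: le_trans rs].
Qed.

(* Only radii r >= 1 matter for the dimension, and there r ^ alpha <= r ^ beta. *)
Lemma ball_growth_radius1 (R : realType) (mu : probability (@Dclass R 1) R)
    (w : equivariantProcess (R^o : metricType R)) (c alpha beta M : R) :
  0 < alpha -> 0 < c -> alpha <= beta ->
  ball_growth mu w c alpha M ->
  ball_growth mu w (c * (Num.max 1 M) `^ alpha) beta 1.
Proof.
move=> al0 c0 ab wgrow.
have Fmu : Filter (almost_everywhere mu) by exact: ae_filter_ringOfSetsType.
rewrite /ball_growth /almost_surely in wgrow *.
apply: filterS wgrow => a; apply: filterS => om wM r r1.
(* For [1 <= r <= K] the ball lies in the one of radius [K], where the hypothesis gives
   [c * K ^ alpha]; for [r > K] the hypothesis applies at [r] itself. *)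
set K := Num.max 1 M.
have K1 : 1 <= K by rewrite le_max lexx.
have [rK|Kr] := leP r K.
  have /(_ K) := wM; rewrite le_max lexx orbT => /(_ isT) wK.
  apply: (le_trans (weight_cball_le _ rK)); apply: (le_trans wK).
  rewrite lee_fin ler_peMr//.
    by rewrite mulr_ge0 ?powR_ge0// ltW.
  by rewrite -(powRr0 r) ler_powR// (le_trans (ltW al0)).
have Mr : M <= r by apply: le_trans (ltW Kr); rewrite le_max lexx orbT.
apply: (le_trans (wM r Mr)); rewrite lee_fin -mulrA ler_pM2l//.
rewrite -[leLHS]mul1r ler_pM ?powR_ge0 ?ler_powR//.
by rewrite -(powRr0 K) ler_powR// ltW.
Qed.

Theorem theorem2p2 (R : realType) (mu : probability (@Dclass R 1) R)
    (mu_unimodular : unimodular mu)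
    (alpha c M : R) (alpha_gt0 : 0 < alpha) (c_gt0 : 0 < c) (M_gt0 : 0 < M)
    (w : equivariantProcess R^o) (w_ge0 : nonneg_process w)
    (w_growth : almost_surely mu w (fun x : markedSpace 1 R^o =>
      forall r : R, M <= r ->
        (weight (cball r (origin x)) <= (c * r `^ alpha)%:E)%E)) :
  ((c^-1)%:E * expect mu w (fun x => (mark (origin x) : R)%:E) <=
     hausdorff_content mu alpha M)%E /\
  ((0 < proba mu w (fun x => exists v : x, mark v <> 0%R :> R))%E ->
     (udimH mu <= alpha%:E)%E).
Proof.
split; first exact: expect_weight_le_content.
move=> /(expect_weight_gt0 mu_unimodular w_ge0) w_gt0.
rewrite /udimH ge_max lee_fin (ltW alpha_gt0)/=.
apply: ge_ereal_sup => _ [beta [beta0 content0] <-]; rewrite lee_fin leNgt.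
(* If [beta > alpha] had content 0, the first part for [beta] at radius 1 would bound a positive
   quantity by 0. *)
apply/negP => ab.
have K_gt0 : 0 < c * Num.max 1 M `^ alpha.
  by rewrite mulr_gt0// powR_gt0// lt_max ltr01.
have := expect_weight_le_content mu_unimodular K_gt0 (lt_trans alpha_gt0 ab)
  ltr01 w_ge0 (ball_growth_radius1 alpha_gt0 c_gt0 (ltW ab) w_growth).
by rewrite content0 leNgt mule_gt0// lte_fin invr_gt0.
Qed.
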